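(* Let $\mathcal{C}$ be an $[n,k,d]$-linear code over a field $\mathbb{K}$ with Tutte polynomial $T_{\mathcal{C}}(x,y)$. Let $p$ be the largest power of $y$ in a term of the form $xy^p$ that appears (with nonzero coefficient) in $T_{\mathcal{C}}(x+1,y)$. Then $$d=n-p-k+1.$$ Moreover, the coefficient of this term $xy^p$ in $T_{\mathcal{C}}(x+1,y)$ is the number of projective codewords of minimum weight of $\mathcal{C}$.
   Context: An $[n,k,d]$-linear code $\mathcal{C}$ over a field $\mathbb{K}$ is the image of an injective linear map $\mathbb{K}^k\to\mathbb{K}^n$, $\mathbf{x}\mapsto \mathbf{x}G$, where $G$ is a $k\times n$ matrix over $\mathbb{K}$ of rank $k\ge1$ (a generating matrix). The elements of $\mathcal{C}$ are codewords; the weight of a vector is its number of nonzero entries, and the minimum distance $d$ is the smallest weight of a nonzero codeword. A projective codeword is a nonzero codeword considered up to multiplication by nonzero scalars; one of minimum weight has weight $d$. The Tutte polynomial of $\mathcal{C}$ is $$T_{\mathcal{C}}(x,y)=\sum_{I\subseteq[n]}(x-1)^{k-r(I)}(y-1)^{|I|-r(I)},$$ where $[n]=\{1,\ldots,n\}$, $r(I)$ is the dimension of the linear span of the columns of $G$ indexed by $I$, and $|I|$ is the cardinality of $I$. *)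

(* Defs.v *)
From mathcomp Require Import all_boot all_order all_algebra.
From mathcomp Require Import boolp classical_sets functions cardinality.

Set Implicit Arguments.
Unset Strict Implicit.
Unset Printing Implicit Defensive.

Import Order.TTheory GRing.Theory Num.Theory.

Local Open Scope classical_set_scope.
Local Open Scope ring_scope.

Definition generating_matrix (K : fieldType) (n k : nat)
    (G : 'M[K]_(k, n)) (C : set 'rV[K]_n) : Prop :=
  [/\ (1 <= k)%N, \rank G = k & C = range (fun x : 'rV[K]_k => x *m G)].

Definition weight (K : fieldType) (n : nat) (c : 'rV[K]_n) : nat :=
  #|[pred j : 'I_n | c 0 j != 0]|.

Definition minimum_distance (K : fieldType) (n : nat)
    (C : set 'rV[K]_n) (d : nat) : Prop :=
  (exists c, [/\ C c, c != 0 & weight c = d]) /\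
  (forall c, C c -> c != 0 -> (d <= weight c)%N).

Definition scalar_class (K : fieldType) (n : nat) (c : 'rV[K]_n) :
    set 'rV[K]_n :=
  [set a *: c | a in [set a : K | a != 0]].

(* The weight is constant on scalar classes, so "of weight w" may be read on
   any representative. *)
Definition projective_codewords_of_weight (K : fieldType) (n : nat)
    (C : set 'rV[K]_n) (w : nat) : set (set 'rV[K]_n) :=
  [set scalar_class c | c in [set c | [/\ C c, c != 0 & weight c = w]]].

Definition column_rank_on (K : fieldType) (n k : nat) (G : 'M[K]_(k, n))
    (I : {set 'I_n}) : nat :=
  \dim <<[seq col j G | j in I]>>%VS.

(* As in polyXY, 'X is the outer variable (x) and 'Y := 'X%:P the inner one
   (y): the coefficient of x^i y^j in u is u`_i`_j.  Both truncated
   subtractions are exact when \rank G = k. *)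
Definition tutte (K : fieldType) (n k : nat) (G : 'M[K]_(k, n)) :
    {poly {poly int}} :=
  let r := column_rank_on G in
  \sum_(I : {set 'I_n}) ('X - 1) ^+ (k - r I) * ('Y - 1) ^+ (#|I| - r I).

Definition largest_xy_power (u : {poly {poly int}}) (p : nat) : Prop :=
  u`_1`_p != 0 /\ (forall q : nat, u`_1`_q != 0 -> (q <= p)%N).

(* Main.v *)
Require Import Defs.
From mathcomp Require Import all_boot all_order all_algebra.
From mathcomp Require Import finmap zify.
From mathcomp Require Import boolp classical_sets functions cardinality.

(** Since [T(x + 1, y)] is the sum of [x ^ (k - r I) * (y - 1) ^ (#|I| - r I)],
    the coefficient of [x] is the sum of [(y - 1) ^ (#|I| - (k - 1))] over the
    column sets [I] of rank [k - 1] ([tutte_shift_coef]). All the summands are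
    monic, so nothing cancels at the top: the degree [p] is [m - (k - 1)], where
    [m] is the largest size of such an [I], and the leading coefficient is the
    number of those [I] of size [m] ([coef_sum_exp_XsubC_top]).

    What remains is to read these sets in the code. The message vectors are
    the linear forms on the space of columns, so a column set has rank less
    than [k] exactly when some nonzero codeword vanishes on it
    ([column_rank_on_ltP], [column_rank_on_lt_codewordP]). A nonzero codeword
    has at most [n - d] zeros, which bounds the sizes of the sets of rank less
    than [k]; this bound forces the zero set of a codeword of minimum weight to
    have rank exactly [k - 1] ([column_rank_zero_set]), so [m = n - d] and
    [d = n - p - k + 1]. The sets counted by the leading coefficient are
    precisely the zero sets of the codewords of minimum weight
    ([min_weight_codeword_vanishing]), and two such codewords with the same zero
    set are proportional ([scalar_class_zero_set]); hence the count is the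
    number of projective codewords of weight [d]. *)

Set Implicit Arguments.
Unset Strict Implicit.
Unset Printing Implicit Defensive.

Import Order.TTheory GRing.Theory Num.Theory.

Local Open Scope classical_set_scope.
Local Open Scope card_scope.
Local Open Scope ring_scope.

(** * Top coefficients of sums of powers of ['X - a] *)

Lemma coef_exp_XsubC_gt (R : nzRingType) (a : R) (e q : nat) :
  (e < q)%N -> (('X - a%:P) ^+ e)`_q = 0.
Proof. by move=> ltq; rewrite nth_default // size_exp_XsubC. Qed.

Lemma coef_exp_XsubC_top (R : nzRingType) (a : R) (e : nat) :
  (('X - a%:P) ^+ e)`_e = 1.
Proof.
have /eqP := monic_exp e (monicXsubC a).
by rewrite lead_coefE size_exp_XsubC.
Qed.

Lemma coef_sum_exp_XsubC_gt (R : nzRingType) (J : finType) (P : pred J)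
    (e : J -> nat) (a : R) (m q : nat) :
  (forall j, P j -> (e j <= m)%N) -> (m < q)%N ->
  (\sum_(j | P j) ('X - a%:P) ^+ e j)`_q = 0.
Proof.
move=> le_em ltq; rewrite coef_sum big1 // => j Pj.
by rewrite coef_exp_XsubC_gt // (leq_ltn_trans (le_em j Pj)).
Qed.

(** The summands are monic, so no cancellation can occur in degree [m]. *)
Lemma coef_sum_exp_XsubC_top (R : nzRingType) (J : finType) (P : pred J)
    (e : J -> nat) (a : R) (m : nat) :
  (forall j, P j -> (e j <= m)%N) ->
  (\sum_(j | P j) ('X - a%:P) ^+ e j)`_m = #|[pred j | P j & e j == m]|%:R.
Proof.
move=> le_em; rewrite coef_sum -sumr_const [RHS]big_mkcondr.
apply: eq_bigr => j Pj; case: eqVneq => [->|ne_em].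
  exact: coef_exp_XsubC_top.
by rewrite coef_exp_XsubC_gt // ltn_neqAle ne_em le_em.
Qed.

(** * The coefficient of [x] in [T(x + 1, y)] *)

(** The shift of [x] turns the factor [(x - 1) ^ (k - r I)] into a power of
    [x], so each coefficient collects the column sets of one rank. *)
Lemma tutte_shift_coef (K : fieldType) (n k : nat) (G : 'M[K]_(k, n))
    (i : nat) :
  (tutte G \Po ('X + 1))`_i =
  \sum_(I : {set 'I_n} | (k - column_rank_on G I)%N == i)
     ('X - 1) ^+ (#|I| - column_rank_on G I).
Proof.
rewrite /tutte raddf_sum /= coef_sum [RHS]big_mkcond; apply: eq_bigr => I _.
rewrite rmorphM !rmorphXn !rmorphB /= comp_polyX comp_polyC.
rewrite comp_polyC -polyCB -polyC_exp polyC1 addrK coefMC coefXn eq_sym.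
by case: eqP; rewrite ?mul1r ?mul0r.
Qed.

(** * Ranks of sets of columns *)

Section ColumnRank.

Context (K : fieldType) (n k : nat).
Implicit Types (G : 'M[K]_(k, n)) (I : {set 'I_n}).

Lemma column_rank_on_le G I : (column_rank_on G I <= k)%N.
Proof. by rewrite (leq_trans (dimvS (subvf _))) // dimvf /dim /= muln1. Qed.

Lemma column_rank_on_card G I : (column_rank_on G I <= #|I|)%N.
Proof. by rewrite (leq_trans (dim_span _)) // size_map -cardE. Qed.

Lemma column_rank_on_setU1 G I (j : 'I_n) :
  (column_rank_on G (j |: I) <= (column_rank_on G I).+1)%N.
Proof.
set U := <<[seq col j G | j in I]>>%VS.
have sub : (<<[seq col j G | j in j |: I]%SET>> <= <[col j G]> + U)%VS.
  apply/span_subvP => v /mapP[i]; rewrite mem_enum in_setU1 => iI ->.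
  case/predU1P: iI => [->|iI]; first exact: (subvP (addvSl _ _)) (memv_line _).
  apply: (subvP (addvSr _ _)); apply: memv_span.
  by apply: map_f; rewrite mem_enum.
apply: leq_trans (dimvS sub) _; apply: leq_trans (dimv_add_leqif _ _) _.
by rewrite dim_vline; apply: (leq_add (leq_b1 _) (leqnn _)).
Qed.

(** A proper subspace of the space of columns lies in the kernel of a nonzero
    linear form, and linear forms on columns are the message vectors [x]. *)
Lemma column_rank_on_ltP G I :
  (column_rank_on G I < k)%N <->
  exists2 x : 'rV[K]_k, x != 0 & forall j, j \in I -> (x *m G) 0 j = 0.
Proof.
rewrite /column_rank_on; set U := <<_>>%VS.
have mem_col j : j \in I -> col j G \in U.
  by move=> jI; apply/memv_span/map_f; rewrite mem_enum.
have coordE (x : 'rV_k) j : (x *m G) 0 j = (x *m col j G) 0 0.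
  by rewrite !mxE; apply: eq_bigr => i _; rewrite mxE.
split=> [ltU | [x nz_x x0]].
  (* The columns of [B] form a basis of [U], so [x] kills [U] as soon as it is
     in the left kernel of [B], which is nonzero as [B] has fewer than [k]
     columns. *)
  pose B : 'M[K]_(k, \dim U) := \matrix_(i, l) ((vbasis U)`_l : 'cV_k) i 0.
  have kerB : kermx B != 0.
    rewrite kermx_eq0 /row_free neq_ltn.
    by rewrite (leq_ltn_trans (rank_leq_col B) ltU).
  have [x /sub_kermxP xB nz_x] := rowV0Pn kerB.
  have xb (l : 'I_(\dim U)) : x *m (vbasis U)`_l = 0.
    have -> : (vbasis U)`_l = col l B by apply/colP=> i; rewrite !mxE.
    by rewrite !colE mulmxA xB mul0mx.
  exists x => // j /mem_col /coord_vbasis; rewrite coordE => ->.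
  rewrite mulmx_sumr summxE big1 // => l _.
  by rewrite -scalemxAr xb scaler0 mxE.
have subU : (U <= lker (linfun (mulmx x : 'cV_k -> 'cV_1)))%VS.
  apply/span_subvP => v /mapP[j]; rewrite mem_enum => jI ->.
  rewrite memv_ker lfunE /=; apply/eqP/matrixP=> a b.
  by rewrite !ord1 -coordE x0 // mxE.
rewrite ltn_neqAle column_rank_on_le andbT; apply: contra nz_x => /eqP dimU.
(* If [U] were everything, [x] would kill the canonical basis. *)
have fullU : (fullv <= U)%VS.
  have: U == fullv by rewrite eqEdim subvf dimvf /dim /= muln1 dimU.
  by move/eqP->; apply: subvv.
apply/eqP/rowP=> i; have := subvP (subv_trans fullU subU) (delta_mx i 0) (memvf _).
rewrite memv_ker lfunE /= -colE => /eqP/matrixP/(_ 0 0).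
by rewrite !mxE.
Qed.

End ColumnRank.

(** * Zero sets of codewords of minimum weight *)

Definition zero_set (K : fieldType) (n : nat) (c : 'rV[K]_n) : {set 'I_n} :=
  [set j | c 0 j == 0]%SET.

Lemma weight_zero_set (K : fieldType) (n : nat) (c : 'rV[K]_n) :
  (weight c + #|zero_set c| = n)%N.
Proof.
rewrite -[RHS](card_ord n) -(cardC (mem (zero_set c))) addnC; congr addn.
by apply: eq_card => j; rewrite !inE.
Qed.

Lemma card_zero_set (K : fieldType) (n : nat) (c : 'rV[K]_n) :
  #|zero_set c| = (n - weight c)%N.
Proof. by rewrite -[X in (X - _)%N](weight_zero_set c) addKn. Qed.

Lemma zero_set_scalar_class (K : fieldType) (n : nat) (c c' : 'rV[K]_n) :
  scalar_class c = scalar_class c' -> zero_set c = zero_set c'.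
Proof.
move=> eqcc'; have : scalar_class c c.
  by exists 1; [exact: oner_neq0 | rewrite scale1r].
rewrite eqcc' => -[a /= nz_a <-]; apply/setP=> j.
by rewrite !inE mxE mulf_eq0 (negPf nz_a).
Qed.

Lemma scalar_class_scale (K : fieldType) (n : nat) (a : K) (c : 'rV[K]_n) :
  a != 0 -> scalar_class (a *: c) = scalar_class c.
Proof.
move=> nz_a; apply/seteqP; split=> _ [b /= nz_b <-].
  by exists (b * a); rewrite /= ?mulf_neq0 // scalerA.
by exists (b / a); rewrite /= ?mulf_neq0 ?invr_eq0 // scalerA divfK.
Qed.

Section MinimumWeight.

Context (K : fieldType) (n k d : nat) (C : set 'rV[K]_n) (G : 'M[K]_(k, n)).
Context (hG : generating_matrix G C) (hd : minimum_distance C d).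

Lemma column_rank_on_lt_codewordP (I : {set 'I_n}) :
  (column_rank_on G I < k)%N <->
  exists c, [/\ C c, c != 0 & I \subset zero_set c].
Proof.
have [_ rkG ->] := hG; have freeG : row_free G by rewrite /row_free rkG.
rewrite column_rank_on_ltP; split=> [[x nz_x x0]|[_ [[x _ <-] nz_xG sIx]]].
  exists (x *m G); split; first by exists x.
    apply: contra nz_x => /eqP xG0; apply/eqP/(row_free_inj freeG).
    by rewrite xG0 mul0mx.
  by apply/fintype.subsetP=> j /x0 xj; rewrite inE xj.
exists x; first by apply: contraNneq nz_xG => ->; rewrite mul0mx.
by move=> j /(fintype.subsetP sIx); rewrite inE => /eqP.
Qed.

Lemma min_distance_column_rank (I : {set 'I_n}) :
  (column_rank_on G I < k)%N -> (d + #|I| <= n)%N.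
Proof.
case/column_rank_on_lt_codewordP=> c [Cc nz_c /subset_leq_card leI].
by have := weight_zero_set c; have := hd.2 c Cc nz_c; lia.
Qed.

(** The zero set of a codeword of minimum weight is a hyperplane of the column
    matroid: any column outside it would otherwise enlarge it to a set of
    non-maximal rank, hence to the zero set of a lighter codeword. *)
Lemma column_rank_zero_set (c : 'rV[K]_n) :
  C c -> c != 0 -> weight c = d -> column_rank_on G (zero_set c) = k.-1.
Proof.
move=> Cc nz_c wc.
have ltk : (column_rank_on G (zero_set c) < k)%N.
  by apply/column_rank_on_lt_codewordP; exists c.
have /rV0Pn[j nz_cj] := nz_c.
have nzZ : j \notin zero_set c by rewrite inE.
have leS := column_rank_on_setU1 G (zero_set c) j.
suff: (k <= column_rank_on G (j |: zero_set c))%N by lia.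
rewrite leqNgt; apply/negP => /min_distance_column_rank.
rewrite cardsU1 nzZ; have := weight_zero_set c; lia.
Qed.

(** Conversely, a nonzero codeword vanishing on so large a set has weight at
    most [d], so it has no further zeros. *)
Lemma min_weight_codeword_vanishing (I : {set 'I_n}) :
  (column_rank_on G I < k)%N -> #|I| = (n - d)%N ->
  exists c, [/\ C c, c != 0, weight c = d & zero_set c = I].
Proof.
case/column_rank_on_lt_codewordP=> c [Cc nz_c sIc] cardI.
have lew := hd.2 c Cc nz_c; have wz := weight_zero_set c.
have leI := subset_leq_card sIc.
exists c; split=> //; first lia.
by apply/esym/eqP; rewrite eqEcard sIc; lia.
Qed.

(** Eliminating one more coordinate between two codewords with the same zero
    set leaves a codeword lighter than the minimum distance, that is, zero. *)
Lemma scalar_class_zero_set (c c' : 'rV[K]_n) :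
  C c -> C c' -> c != 0 -> weight c = d -> zero_set c = zero_set c' ->
  scalar_class c = scalar_class c'.
Proof.
have [_ _ defC] := hG.
move=> Cc Cc' nz_c wc eqZ; have /rV0Pn[j nz_cj] := nz_c.
have nzZ : j \notin zero_set c by rewrite inE.
have nz_cj' : c' 0 j != 0.
  by have /setP/(_ j) := eqZ; rewrite !inE (negPf nz_cj) => <-.
(* With this ratio, [c - a *: c'] has the further zero [j]. *)
pose a := c 0 j / c' 0 j.
have nz_a : a != 0 by rewrite mulf_neq0 ?invr_eq0.
have [->|ne_cc'] := eqVneq c (a *: c'); first exact: scalar_class_scale.
have Ce : C (c - a *: c').
  move: Cc Cc'; rewrite defC => -[x _ <-] [x' _ <-].
  by exists (x - a *: x') => //; rewrite mulmxBl scalemxAl.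
have no_light e : C e -> e != 0 -> ~ (j |: zero_set c)%SET \subset zero_set e.
  move=> Ce' nz_e /subset_leq_card sub.
  have ltZ : (#|zero_set c| < #|zero_set e|)%N.
    by apply: leq_trans sub; rewrite cardsU1 nzZ.
  have := hd.2 e Ce' nz_e; have := weight_zero_set c.
  have := weight_zero_set e; lia.
case: (no_light _ Ce); first by rewrite subr_eq0.
apply/fintype.subsetP=> i; rewrite in_setU1 => /predU1P[->|iZ].
  by rewrite inE !mxE divfK // subrr.
move: (iZ); rewrite eqZ => iZ'; rewrite inE in iZ; rewrite inE in iZ'.
by rewrite inE !mxE (eqP iZ) (eqP iZ') mulr0 subr0.
Qed.

End MinimumWeight.

(** * Counting minimum weight codewords in the Tutte polynomial *)

Lemma card_eq_pred (T : finType) (P : pred T) : [set x | P x] #= `I_#|P|.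
Proof.
rewrite (_ : [set x | P x] = [set` [fset x | x in P]%fset]).
  by apply/card_eq_fsetP; rewrite card_imfset //= -cardE.
by apply/seteqP; split=> x /=; rewrite inE.
Qed.

(** Taking zero sets is a bijection from the projective codewords of minimum
    weight onto the sets on the right; the proof runs it backwards, choosing a
    codeword for each set. *)
Lemma projective_min_weight_card (K : fieldType) (n k d : nat)
    (C : set 'rV[K]_n) (G : 'M[K]_(k, n)) :
  generating_matrix G C -> minimum_distance C d ->
  projective_codewords_of_weight C d #=
  `I_#|[pred I : {set 'I_n} | column_rank_on G I == k.-1 & #|I| == (n - d)%N]|.
Proof.
move=> hG hd; set F := [pred I | _ & _].
have [k_gt0 _ _] := hG.
have ex_c (I : {set 'I_n}) : exists c,
    F I -> [/\ C c, c != 0, weight c = d & zero_set c = I].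
  (* The value 0 only makes the choice function total. *)
  have [/andP[/eqP rI /eqP cI]|nFI] := boolP (F I); last by exists 0.
  have ltI : (column_rank_on G I < k)%N by rewrite rI prednK.
  by have [c cP] := min_weight_codeword_vanishing hG hd ltI cI; exists c.
have [f fP] := choice ex_c.
have -> : projective_codewords_of_weight C d =
          [set scalar_class (f I) | I in [set I | F I]].
  apply/seteqP; split=> [_ [c [Cc nz_c wc] <-]|_ [I FI <-]]; last first.
    by have [Cf nz_f wf _] := fP I FI; exists (f I).
  have Fc : F (zero_set c).
    rewrite /F /= (column_rank_zero_set hG hd) // eqxx /=.
    by rewrite card_zero_set wc.
  have [Cf nz_f wf zf] := fP _ Fc; exists (zero_set c) => //.
  exact: (scalar_class_zero_set hG hd).
apply: card_eq_trans (card_eq_pred F); apply: inj_card_eq => I J.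
rewrite !inE => FI FJ /zero_set_scalar_class.
by have [_ _ _ ->] := fP I FI; have [_ _ _ ->] := fP J FJ.
Qed.

(** A set of rank [k - 1] has at most [n - d] elements, so [n - d - (k - 1)]
    bounds all the exponents of [y - 1] that occur with [x]. *)
Lemma tutte_xy_coef (K : fieldType) (n k d : nat)
    (C : set 'rV[K]_n) (G : 'M[K]_(k, n)) :
  generating_matrix G C -> minimum_distance C d ->
  let p := (n - d - k.-1)%N in
  (tutte G \Po ('X + 1))`_1`_p =
    #|[pred I : {set 'I_n} | column_rank_on G I == k.-1 & #|I| == (n - d)%N]|%:R
  /\ (forall q, (p < q)%N -> (tutte G \Po ('X + 1))`_1`_q = 0).
Proof.
move=> hG hd p; have [k_gt0 _ _] := hG.
have rankE I : (k - column_rank_on G I == 1)%N = (column_rank_on G I == k.-1).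
  by have := column_rank_on_le G I; lia.
have coefE : (tutte G \Po ('X + 1))`_1 =
    \sum_(I : {set 'I_n} | column_rank_on G I == k.-1)
       ('X - 1%:P) ^+ (#|I| - k.-1).
  by rewrite tutte_shift_coef; apply: eq_big => // I; rewrite rankE => /eqP->.
have bnd (I : {set 'I_n}) : column_rank_on G I == k.-1 ->
    (k.-1 <= #|I| <= n - d)%N.
  move=> /eqP rI; have := column_rank_on_card G I.
  have := @min_distance_column_rank _ _ _ _ _ _ hG hd I; lia.
have le_p I : column_rank_on G I == k.-1 -> (#|I| - k.-1 <= p)%N.
  by move=> /bnd; rewrite /p; lia.
rewrite coefE; split=> [|q]; last exact: coef_sum_exp_XsubC_gt.
rewrite coef_sum_exp_XsubC_top //; congr _%:R; apply: eq_card => I.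
rewrite !inE; case: eqP => //= /eqP/bnd/andP[leI leIn].
by rewrite -(eqn_add2r k.-1) /p !subnK ?(leq_trans leI).
Qed.

Theorem lemma1p1 (K : fieldType) (n k d : nat)
    (C : set 'rV[K]_n) (G : 'M[K]_(k, n))
    (hG : generating_matrix G C) (hd : minimum_distance C d) :
  (exists p : nat, largest_xy_power (tutte G \Po ('X + 1)) p) /\
  (forall p : nat, largest_xy_power (tutte G \Po ('X + 1)) p ->
    d%:Z = n%:Z - p%:Z - k%:Z + 1 /\
    exists N : nat,
      projective_codewords_of_weight C d #= `I_N /\
      (tutte G \Po ('X + 1))`_1`_p = N%:Z).
Proof.
have [k_gt0 _ _] := hG; have [[c [Cc nz_c wc]] _] := hd.
have := projective_min_weight_card hG hd.
have := tutte_xy_coef hG hd.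
set F := [pred I | _ & _] => /= -[top_p gt_p] cardF.
have rZ := column_rank_zero_set hG hd Cc nz_c wc.
have wZ := weight_zero_set c.
have F_gt0 : (0 < #|F|)%N.
  by apply/card_gt0P; exists (zero_set c); rewrite inE rZ card_zero_set wc !eqxx.
have le_r := column_rank_on_card G (zero_set c).
have maxp : largest_xy_power (tutte G \Po ('X + 1)) (n - d - k.-1).
  split=> [|q]; first by rewrite top_p pnatr_eq0 -lt0n.
  by apply: contraNT; rewrite -ltnNge => /gt_p ->.
split=> [|p [nz_p max_p]]; first by exists (n - d - k.-1)%N.
have -> : p = (n - d - k.-1)%N.
  by apply/eqP; rewrite eqn_leq maxp.2 // max_p ?maxp.1.
split; first lia.
by exists #|F|; rewrite top_p -natz.
Qed.
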